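(* For any continuous dcpo $A$ with a countable basis, there exists a CC-valuation $\mu$ on the system of Scott open subsets of $A$.
   Context: Directed sets are nonempty. A dcpo is a poset with least element $\bot$ in which every directed subset $S$ has a least upper bound $\sqcup S$. $x\ll y$ means: for every directed $S$ with $y\sqsubseteq\sqcup S$ there is $s\in S$ with $x\sqsubseteq s$. A dcpo $A$ is continuous with basis $K\subseteq A$ if for every $a\in A$ the set $K_a=\{k\in K\mid k\ll a\}$ is directed and $a=\sqcup K_a$. $U\subseteq A$ is Scott open if it is upward closed and $\sqcup S\in U$ with $S$ directed implies $S\cap U\ne\emptyset$. $\mathrm{Int}$ is interior in the Scott topology. A valuation on the lattice $\mathcal O$ of open sets of a space $X$ is $\mu:\mathcal O\to[0,+\infty]$ with $\mu(\emptyset)=0$; $U\subseteq V\Rightarrow\mu(U)\le\mu(V)$; $\mu(U)+\mu(V)=\mu(U\cap V)+\mu(U\cup V)$. It is normalized if $\mu(X)=1$; continuous if $\mu(\bigcup_{i\in I}U_i)=\sup_{i\in I}\mu(U_i)$ for every directed system $\{U_i\}_{i\in I}$ of open sets (directed by inclusion, nonempty); strongly non-degenerate if $U\subsetneq V$ implies $\mu(U)<\mu(V)$ for open $U,V$; co-continuous if $\mu(\mathrm{Int}(\bigcap_{i\in I}U_i))=\inf_{i\in I}\mu(U_i)$ for every filtered (nonempty, downward directed by inclusion) system $\{U_i\}_{i\in I}$ of open sets. A CC-valuation is a continuous, normalized, strongly non-degenerate, co-continuous valuation. *)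

(* Defs.v *)
From HB Require Import structures.
From mathcomp Require Import all_boot all_order all_algebra.
From mathcomp Require Import all_classical all_reals all_analysis.

Set Implicit Arguments.
Unset Strict Implicit.
Unset Printing Implicit Defensive.

Import Order.TTheory GRing.Theory Num.Theory.

Local Open Scope classical_set_scope.
Local Open Scope ring_scope.

Definition directed (T : Type) (le : T -> T -> Prop) (S : set T) : Prop :=
  S !=set0 /\
  forall x y, S x -> S y -> exists z, [/\ S z, le x z & le y z].

Definition directed_set (d : Order.disp_t) (A : porderType d) (S : set A) :
    Prop :=
  directed (fun x y : A => (x <= y)%O) S.

(* The least element is part of the type [bPOrderType]; [supremums S] is the
   set of least upper bounds of [S]. *)
Definition is_dcpo (d : Order.disp_t) (A : bPOrderType d) : Prop :=
  forall S : set A, directed_set S -> exists x, supremums S x.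

Definition way_below (d : Order.disp_t) (A : porderType d) (x y : A) : Prop :=
  forall (S : set A) (s : A), directed_set S -> supremums S s -> (y <= s)%O ->
  exists2 z, S z & (x <= z)%O.

Definition continuous_with_basis (d : Order.disp_t) (A : porderType d)
    (K : set A) : Prop :=
  forall a : A, let Ka := [set k | K k /\ way_below k a] in
  directed_set Ka /\ supremums Ka a.

Definition scott_open (d : Order.disp_t) (A : porderType d) (U : set A) :
    Prop :=
  (forall x y : A, (x <= y)%O -> U x -> U y) /\
  (forall (S : set A) (s : A), directed_set S -> supremums S s -> U s ->
   S `&` U !=set0).

(* A copy of the carrier of [A] that bears the Scott topology. *)
Definition scott (d : Order.disp_t) (A : porderType d) : Type := A.

HB.instance Definition _ (d : Order.disp_t) (A : porderType d) :=
  Choice.on (scott A).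

Section scott_topology.
Variables (d : Order.disp_t) (A : porderType d).

Lemma scott_openT : scott_open [set: A].
Proof. by split=> // S s [[x Sx] _] _ _; exists x. Qed.

Lemma scott_openI : setI_closed (@scott_open d A).
Proof.
move=> U V [upU inU] [upV inV]; split=> [x y xy [Ux Vx]|S s dS sS [Us Vs]].
  by split; [exact: upU Ux|exact: upV Vx].
have [x [Sx Ux]] := inU _ _ dS sS Us.
have [y [Sy Vy]] := inV _ _ dS sS Vs.
have [z [Sz xz yz]] := dS.2 _ _ Sx Sy.
by exists z; split=> //; split; [exact: upU Ux|exact: upV Vy].
Qed.

Lemma scott_open_bigcup (I : Type) (f : I -> set A) :
  (forall i, scott_open (f i)) -> scott_open (\bigcup_i f i).
Proof.
move=> fo; split=> [x y xy [i _ fx]|S s dS sS [i _ fs]].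
  by exists i => //; exact: (fo i).1 fx.
by have [x [Sx fx]] := (fo i).2 _ _ dS sS fs; exists x; split=> //; exists i.
Qed.

HB.instance Definition _ := isOpenTopological.Build (scott A)
  scott_openT scott_openI scott_open_bigcup.

Lemma open_scottE (U : set (scott A)) : open U = scott_open (U : set A).
Proof. by []. Qed.

End scott_topology.

(* A valuation is represented by a function on all sets; only its values on
   open sets are constrained or used. *)
Section valuations.
Variables (R : realType) (X : topologicalType) (mu : set X -> \bar R).
Local Open Scope ereal_scope.

Definition valuation : Prop :=
  [/\ forall U, open U -> 0 <= mu U,
      mu set0 = 0,
      forall U V, open U -> open V -> U `<=` V -> mu U <= mu V &
      forall U V, open U -> open V ->
        mu U + mu V = mu (U `&` V) + mu (U `|` V)].

Definition normalized : Prop := mu setT = 1.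

Definition continuous_valuation : Prop :=
  forall (I : Type) (U : I -> set X), (forall i, open (U i)) ->
  directed subset (range U) ->
  mu (\bigcup_i U i) = ereal_sup (range (fun i => mu (U i))).

Definition strongly_nondegenerate : Prop :=
  forall U V, open U -> open V -> U `<` V -> mu U < mu V.

Definition cocontinuous : Prop :=
  forall (I : Type) (U : I -> set X), (forall i, open (U i)) ->
  directed (fun V W => W `<=` V) (range U) ->
  mu (interior (\bigcap_i U i)) = ereal_inf (range (fun i => mu (U i))).

Definition CC_valuation : Prop :=
  valuation /\ [/\ continuous_valuation, normalized, strongly_nondegenerate &
                   cocontinuous].

End valuations.

(* Main.v *)
(* Point masses are not co-continuous on a non-algebraic domain, so the mass is
   spread along chains: for a << b, interpolation gives a chain from b down to a
   indexed by the dyadic numbers of [0, 1] and strictly decreasing for <<, and an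
   open U gets the length of the part of the chain that lies in U. Open sets are
   linearly ordered by their traces on the chain, hence modularity; a chain point
   in every U_i has in its way-above set, which is open, all strictly higher
   points of the chain, hence co-continuity. A chain from b to a separates U from
   V when b is outside U and a is in V; the basis provides such a << b whenever U
   is properly included in V, so the sum over all pairs of basis elements with
   weights 2^-(n+1) is strongly non-degenerate. *)
Require Import Defs.
From mathcomp Require Import all_boot all_order all_algebra.
From mathcomp Require Import all_classical all_reals all_analysis.
From mathcomp Require Import lra.
Import Order.TTheory GRing.Theory Num.Theory numFieldNormedType.Exports.
Local Open Scope ring_scope.
Local Open Scope classical_set_scope.

Set Implicit Arguments.
Unset Strict Implicit.

(** * Continuous posets *)

Lemma way_below_le (d : Order.disp_t) (A : porderType d) (x y : A) :
  way_below x y -> (x <= y)%O.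
Proof.
move=> /(_ [set y] y); case=> //.
- by split=> [|? ? -> ->]; exists y.
- by split=> [? -> //|z]; apply.
- by move=> _ ->.
Qed.

Lemma way_below_le_trans (d : Order.disp_t) (A : porderType d) (x y z : A) :
  way_below x y -> (y <= z)%O -> way_below x z.
Proof. by move=> xy yz S s dS sS zs; apply: (xy S s) => //; exact: le_trans zs. Qed.

Lemma le_way_below_trans (d : Order.disp_t) (A : porderType d) (x y z : A) :
  (x <= y)%O -> way_below y z -> way_below x z.
Proof.
move=> xy yz S s dS sS zs; have [t St yt] := yz S s dS sS zs.
by exists t => //; exact: le_trans yt.
Qed.

Lemma way_below_trans (d : Order.disp_t) (A : porderType d) (x y z : A) :
  way_below x y -> way_below y z -> way_below x z.
Proof. by move=> xy /way_below_le; exact: way_below_le_trans. Qed.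

Lemma way_below_bot (d : Order.disp_t) (A : bPOrderType d) (x : A) :
  way_below \bot%O x.
Proof. by move=> S s [[z Sz] _] _ _; exists z => //; exact: le0x. Qed.

(* The points of [K] lying two steps of [<<] below [y] are already directed
   with supremum [y]. *)
Lemma way_below_interpolation (d : Order.disp_t) (A : porderType d)
    (K : set A) (x y : A) :
  continuous_with_basis K -> way_below x y ->
  exists m, way_below x m /\ way_below m y.
Proof.
move=> cK xy.
pose D := [set k | K k /\ exists k', [/\ K k', way_below k k' & way_below k' y]].
have [[[k0 [Kk0 k0y]] diry] [uby luby]] := cK y.
have dD : directed_set D.
  split.
    have [[[k1 [Kk1 k10]] _] _] := cK k0.
    by exists k1; split=> //; exists k0.
  move=> k1 k2 [Kk1 [l1 [Kl1 kl1 l1y]]] [Kk2 [l2 [Kl2 kl2 l2y]]].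
  have [l [[Kl ly] l1l l2l]] := diry l1 l2 (conj Kl1 l1y) (conj Kl2 l2y).
  have [[_ dirl] _] := cK l.
  have [k [[Kk kl] k1k k2k]] := dirl k1 k2
    (conj Kk1 (way_below_le_trans kl1 l1l))
    (conj Kk2 (way_below_le_trans kl2 l2l)).
  by exists k; split=> //; split=> //; exists l.
have sD : supremums D y.
  split=> [k [_ [l [_ kl ly]]]|u uD].
    exact/way_below_le/(way_below_trans kl).
  apply: luby => l [Kl ly]; have [_ [_]] := cK l; apply=> k [Kk kl].
  by apply: uD; split=> //; exists l.
have [k [_ [l [_ kl ly]]] xk] := xy D y dD sD (lexx y).
by exists l; split=> //; exact: le_way_below_trans kl.
Qed.

(** Interpolate [x << m << s]: some [z] in [S] lies above [m], hence way above [x]. *)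
Lemma scott_open_way_above (d : Order.disp_t) (A : porderType d)
    (K : set A) (x : A) :
  continuous_with_basis K -> scott_open [set y | way_below x y].
Proof.
move=> cK; split=> [y z yz xy|S s dS sS xs]; first exact: way_below_le_trans yz.
have [m [xm ms]] := way_below_interpolation cK xs.
have [z Sz mz] := ms S s dS sS (lexx s).
by exists z; split=> //; exact: way_below_le_trans mz.
Qed.

Lemma scott_open_basis (d : Order.disp_t) (A : porderType d)
    (K U : set A) (x : A) :
  continuous_with_basis K -> scott_open U -> U x ->
  exists k, [/\ K k, way_below k x & U k].
Proof.
move=> cK [_ iU] Ux; have [dK sK] := cK x.
by have [k [[Kk kx] Uk]] := iU _ _ dK sK Ux; exists k.
Qed.

(** * Chains indexed by a dense set of reals *)

(* [C t x]: the point [x] sits at level [t]; levels increase downwards, from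
   [b] at level [0] to [a] at level [1]. *)
Definition dense_chain (R : realType) (d : Order.disp_t) (A : porderType d)
    (a b : A) (C : R -> set A) : Prop :=
  [/\ C 0 b, C 1 a, forall t x, C t x -> 0 <= t <= 1,
      forall s t x y, s < t -> C s x -> C t y -> way_below y x &
      forall s t, 0 <= s -> s < t -> t <= 1 ->
        exists r x, s < r < t /\ C r x].

(** Row [n] is the grid of step [2^-n], read from [b] down to [a]: even indices repeat row [n - 1],
    odd ones insert midpoints. [mid] takes the lower point first; only indices [i <= 2^n] are
    meaningful. *)
Fixpoint dyadic_chain (T : Type) (mid : T -> T -> T) (a b : T) (n i : nat) : T :=
  match n with
  | 0%N => if i == 0%N then b else a
  | n'.+1 => if odd i
             then mid (dyadic_chain mid a b n' i./2.+1)
                      (dyadic_chain mid a b n' i./2)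
             else dyadic_chain mid a b n' i./2
  end.

(** A point depends only on the dyadic number [i / 2^n], so points of different rows can be compared
    in a common row. *)
Lemma dyadic_chain_refine (T : Type) (mid : T -> T -> T) (a b : T) (n k i : nat) :
  dyadic_chain mid a b (k + n) (2 ^ k * i) = dyadic_chain mid a b n i.
Proof.
elim: k => [|k IH]; first by rewrite mul1n.
by rewrite addSn expnS -mulnA mul2n /= odd_double doubleK.
Qed.

(** For [n > 0], neighbours in a row are a midpoint and one end of the gap that it divides; the
    parity of [i] tells which end. *)
Lemma dyadic_chain_ltS (T : Type) (lt : T -> T -> Prop) (mid : T -> T -> T)
    (a b : T) (n i : nat) :
  (forall x y, lt x y -> lt x (mid x y) /\ lt (mid x y) y) -> lt a b ->
  (i < 2 ^ n)%N -> lt (dyadic_chain mid a b n i.+1) (dyadic_chain mid a b n i).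
Proof.
move=> midP ab; elim: n i => [|n IH] i; first by rewrite expn0; case: i.
rewrite -(odd_double_half i) expnS mul2n.
case: (odd i); rewrite /= ?add1n ?add0n => hi.
  have /IH /midP [h _] : (i./2 < 2 ^ n)%N by rewrite -ltn_double (leq_trans _ hi).
  by rewrite /= odd_double /= uphalf_double doubleK.
have /IH /midP [_ h] : (i./2 < 2 ^ n)%N by rewrite -ltn_double.
by rewrite /= odd_double /= uphalf_double doubleK.
Qed.

Lemma dyadic_chain_lt (T : Type) (lt : T -> T -> Prop) (mid : T -> T -> T)
    (a b : T) (n i j : nat) :
  (forall x y z, lt x y -> lt y z -> lt x z) ->
  (forall x y, lt x y -> lt x (mid x y) /\ lt (mid x y) y) -> lt a b ->
  (i < j)%N -> (j <= 2 ^ n)%N ->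
  lt (dyadic_chain mid a b n j) (dyadic_chain mid a b n i).
Proof.
move=> tr midP ab; elim: j => // j IH; rewrite ltnS leq_eqVlt => /predU1P[->|ij] hj.
  exact: dyadic_chain_ltS.
by apply: tr (IH ij (ltnW hj)); exact: dyadic_chain_ltS.
Qed.

Lemma exists_dense_chain (R : realType) (d : Order.disp_t) (A : porderType d)
    (K : set A) (a b : A) :
  continuous_with_basis K -> way_below a b ->
  exists C : R -> set A, dense_chain a b C.
Proof.
move=> cK ab.
(* Interpolation is made a total function, with an arbitrary value on pairs not related by [<<]. *)
have /choice[mid midP] (p : A * A) : exists m, way_below p.1 p.2 ->
    way_below p.1 m /\ way_below m p.2.
  have [/(way_below_interpolation cK)[m hm]|np] := pselect (way_below p.1 p.2).
    by exists m.
  by exists p.1.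
pose f := dyadic_chain (fun x y => mid (x, y)) a b.
have p2 n : 0 < 2 ^+ n :> R by rewrite exprn_gt0.
exists (fun t => [set x | exists n i, [/\ (i <= 2 ^ n)%N, t = i%:R / 2 ^+ n & x = f n i]]).
split.
- by exists 0%N, 0%N; split=> //; rewrite mul0r.
- by exists 0%N, 1%N; split=> //; rewrite expr0 divr1.
- move=> t x [n [i [hi -> _]]]; apply/andP; split.
    by rewrite divr_ge0// ltW.
  by rewrite ler_pdivrMr// mul1r -natrX ler_nat.
- move=> s t x y st [n [i [hi si ->]]] [m [j [hj tj ->]]].
  rewrite /f -(dyadic_chain_refine _ _ _ n m) -(dyadic_chain_refine _ _ _ m n) addnC.
  apply: dyadic_chain_lt => //.
  + by move=> ? ? ?; exact: way_below_trans.
  + by move=> u v uv; exact: (midP (u, v)).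
  + move: st; rewrite si tj ltr_pdivrMr// mulrAC ltr_pdivlMr//.
    by rewrite -!natrX -!natrM ltr_nat mulnC [in X in (_ < X)%N]mulnC.
  + by rewrite expnD mulnC leq_mul2r hj orbT.
- move=> s t s0 st t1.
  (* Since [2^-n < t - s], the first grid point strictly above [s], at index [i.+1] for [i] the
     integer part of [s * 2^n], comes before [t]. *)
  pose n := Num.bound (t - s)^-1.
  have hn : (t - s)^-1 < 2 ^+ n by exact: upper_nthrootP.
  have ts0 : 0 < t - s by rewrite subr_gt0.
  have hn1 : 1 < (t - s) * 2 ^+ n by rewrite -ltr_pdivrMl// mulr1.
  have s2 : 0 <= s * 2 ^+ n by rewrite mulr_ge0// ltW.
  have /andP[lo hi] := truncn_itv s2.
  set i := Num.trunc (s * 2 ^+ n) in lo hi.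
  have it : i.+1%:R < t * 2 ^+ n.
    by rewrite -natr1; move: hn1; rewrite mulrBl; lra.
  exists (i.+1%:R / 2 ^+ n), (f n i.+1); split.
    by rewrite ltr_pdivlMr// hi ltr_pdivrMr.
  exists n, i.+1; split=> //.
  rewrite -(ler_nat R) natrX (le_trans (ltW it))//.
  by rewrite -[leRHS]mul1r ler_wpM2r// ltW.
Qed.

(* The real-valued conditions of a CC-valuation other than strong
   non-degeneracy, with suprema and infima replaced by approximations. *)
Definition weak_CC (R : realType) (X : topologicalType) (m : set X -> R) : Prop :=
  [/\ m set0 = 0, m setT = 1,
      forall U V, open U -> open V -> U `<=` V -> m U <= m V &
      forall U V, open U -> open V -> m U + m V = m (U `&` V) + m (U `|` V)] /\
  (forall (I : Type) (U : I -> set X), (forall i, open (U i)) ->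
     directed subset (range U) ->
     forall e, 0 < e -> exists i, m (\bigcup_i U i) <= m (U i) + e) /\
  (forall (I : Type) (U : I -> set X), (forall i, open (U i)) ->
     directed (fun V W => W `<=` V) (range U) ->
     forall e, 0 < e -> exists i, m (U i) <= m (interior (\bigcap_i U i)) + e).

(** * Mass of a set along a chain *)

Definition chain_levels (R : realType) (T : Type) (C : R -> set T) (U : set T) : set R :=
  [set t | t = 0 \/ exists2 x, C t x & U x].

(** The levels at which an upper set meets the chain form an initial segment, so the supremum is a
    length. The level [0] put into [chain_levels] gives mass [0] to a set that misses the chain. *)
Definition chain_mass (R : realType) (T : Type) (C : R -> set T) (U : set T) : R :=
  sup (chain_levels C U).

Lemma chain_levels_has_sup (R : realType) (d : Order.disp_t) (A : porderType d)
    (a b : A) (C : R -> set A) (U : set A) :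
  dense_chain a b C -> has_sup (chain_levels C U).
Proof.
move=> [_ _ C01 _ _]; split; first by exists 0; left.
by exists 1 => t [->//|[x /C01/andP[]]].
Qed.

Lemma chain_mass_ge (R : realType) (d : Order.disp_t) (A : porderType d)
    (a b : A) (C : R -> set A) (U : set A) (t : R) (x : A) :
  dense_chain a b C -> C t x -> U x -> t <= chain_mass C U.
Proof.
move=> cC Ctx Ux; apply: sup_upper_bound; first exact: chain_levels_has_sup cC.
by right; exists x.
Qed.

Lemma chain_mass_le (R : realType) (T : Type) (C : R -> set T) (U : set T) (r : R) :
  0 <= r -> (forall t x, C t x -> U x -> t <= r) -> chain_mass C U <= r.
Proof.
move=> r0 Ur; apply: ge_sup; first by exists 0; left.
by move=> t [->//|[x Ctx Ux]]; exact: Ur Ux.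
Qed.

Lemma chain_mass_ge0 (R : realType) (d : Order.disp_t) (A : porderType d)
    (a b : A) (C : R -> set A) (U : set A) :
  dense_chain a b C -> 0 <= chain_mass C U.
Proof.
by move=> cC; apply: sup_upper_bound; [exact: chain_levels_has_sup cC|left].
Qed.

Lemma chain_mass_le1 (R : realType) (d : Order.disp_t) (A : porderType d)
    (a b : A) (C : R -> set A) (U : set A) :
  dense_chain a b C -> chain_mass C U <= 1.
Proof. by move=> [_ _ C01 _ _]; apply: chain_mass_le => // t x /C01/andP[]. Qed.

Lemma chain_mass_gt (R : realType) (d : Order.disp_t) (A : porderType d)
    (a b : A) (C : R -> set A) (U : set A) (r : R) :
  dense_chain a b C -> 0 <= r -> r < chain_mass C U ->
  exists t x, [/\ r < t, C t x & U x].
Proof.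
move=> cC r0 rU; have e0 : 0 < chain_mass C U - r by rewrite subr_gt0.
have [t] := sup_adherent e0 (chain_levels_has_sup U cC).
rewrite -/(chain_mass C U) subKr => -[->|[x Ctx Ux]] rt; last by exists t, x.
by move: rt; rewrite ltNge r0.
Qed.

Lemma chain_mass_subset (R : realType) (d : Order.disp_t) (A : porderType d)
    (a b : A) (C : R -> set A) (U V : set A) :
  dense_chain a b C -> U `<=` V -> chain_mass C U <= chain_mass C V.
Proof.
move=> cC UV; apply: chain_mass_le; first exact: chain_mass_ge0 cC.
by move=> t x Ctx /UV; exact: chain_mass_ge cC Ctx.
Qed.

Lemma chain_massU (R : realType) (d : Order.disp_t) (A : porderType d)
    (a b : A) (C : R -> set A) (U V : set A) :
  dense_chain a b C ->
  chain_mass C (U `|` V) = Num.max (chain_mass C U) (chain_mass C V).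
Proof.
move=> cC; apply/eqP; rewrite eq_le; apply/andP; split.
  apply: chain_mass_le; first by rewrite le_max (chain_mass_ge0 _ cC).
  move=> t x Ctx [Ux|Vx]; rewrite le_max; apply/orP; [left|right];
    exact: chain_mass_ge cC Ctx _.
by rewrite ge_max !(chain_mass_subset cC).
Qed.

(** If both masses exceeded that of the intersection, density would give a chain point beyond the
    latter mass but above a chain point of [U] and one of [V]; it lies in both upper sets, a
    contradiction. *)
Lemma chain_massI (R : realType) (d : Order.disp_t) (A : porderType d)
    (a b : A) (C : R -> set A) (U V : set A) :
  dense_chain a b C -> scott_open U -> scott_open V ->
  chain_mass C (U `&` V) = Num.min (chain_mass C U) (chain_mass C V).
Proof.
move=> cC [upU _] [upV _]; apply/eqP; rewrite eq_le; apply/andP; split.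
  by rewrite le_min !(chain_mass_subset cC).
have r0 := chain_mass_ge0 (U `&` V) cC.
rewrite leNgt lt_min; apply/negP => /andP[].
move=> /(chain_mass_gt cC r0)[s [x [rs Csx Ux]]].
move=> /(chain_mass_gt cC r0)[t [y [rt Cty Vy]]].
have [_ _ C01 Clt Cdense] := cC.
have /andP[_ s1] := C01 _ _ Csx.
have [||q [z [/andP[rq qst] Cqz]]] := Cdense _ (Num.min s t) r0.
- by rewrite lt_min rs.
- by rewrite ge_min s1.
move: qst; rewrite lt_min => /andP[qs qt].
suff : q <= chain_mass C (U `&` V) by rewrite leNgt rq.
apply: (chain_mass_ge cC Cqz); split.
- by apply: upU Ux; exact: way_below_le (Clt _ _ _ _ qs Cqz Csx).
- by apply: upV Vy; exact: way_below_le (Clt _ _ _ _ qt Cqz Cty).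
Qed.

Lemma chain_mass_bigcup (R : realType) (d : Order.disp_t) (A : porderType d)
    (a b : A) (C : R -> set A) (I : Type) (U : I -> set A) (e : R) :
  dense_chain a b C -> inhabited I -> 0 < e ->
  exists i, chain_mass C (\bigcup_i U i) <= chain_mass C (U i) + e.
Proof.
move=> cC [i0] e0; set m := chain_mass C (\bigcup_i U i).
(* If [m <= e] any index works; otherwise one chain point of the union at a level above [m - e]
   selects the index. *)
have [me|em] := leP m e.
  by exists i0; rewrite (le_trans me)// lerDr (chain_mass_ge0 _ cC).
have me0 : 0 <= m - e by rewrite subr_ge0 ltW.
have mem : m - e < m by rewrite ltrBlDr ltrDl.
have [t [x [rt Ctx [i _ Ux]]]] := chain_mass_gt cC me0 mem.
by exists i; rewrite -lerBlDr (le_trans (ltW rt))// (chain_mass_ge cC Ctx).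
Qed.

(* If every [U i] has mass above [m + e], the chain has points [y << x] in all
   [U i] at levels above [m]; then [x] is interior to the intersection. *)
Lemma chain_mass_bigcap (R : realType) (d : Order.disp_t) (A : porderType d)
    (K : set A) (a b : A) (C : R -> set A) (I : Type)
    (U : I -> set (scott A)) (e : R) :
  continuous_with_basis K -> dense_chain a b C -> inhabited I -> 0 < e ->
  (forall i, open (U i)) ->
  exists i, chain_mass C (U i) <= chain_mass C (interior (\bigcap_i U i)) + e.
Proof.
move=> cK cC [i0] e0 oU; set V := interior _; set m := chain_mass C V.
apply: contrapT => /forallNP big.
have {}big i : m + e < chain_mass C (U i) by rewrite ltNge; exact/negP.
have m0 : 0 <= m := chain_mass_ge0 _ cC.
have me1 : m + e <= 1 by rewrite (le_trans (ltW (big i0)))// (chain_mass_le1 _ cC).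
have [_ _ C01 Clt Cdense] := cC.
have mme : m < m + e by rewrite ltrDl.
have [q' [y [/andP[mq' q'e] Cy]]] := Cdense _ _ m0 mme me1.
have [q [x [/andP[mq qq'] Cx]]] := Cdense _ _ m0 mq' (le_trans (ltW q'e) me1).
suff : q <= m by rewrite leNgt mq.
apply: (chain_mass_ge cC Cx).
rewrite /V /interior nbhsE; exists [set z | way_below y z].
  by split; [exact: scott_open_way_above cK|exact: Clt qq' Cx Cy].
(* The level [q'] of [y] is below [m + e], so each [U i] contains a chain point [u] at a deeper
   level; hence it contains [y] and all that lies above [y]. *)
move=> z yz i _; have [t [u [q't Cu Uu]]] : exists t u, [/\ q' < t, C t u & U i u].
  by apply: chain_mass_gt cC _ _; [lra|exact: lt_trans q'e (big i)].
have [upU _] := oU i.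
have Uy := upU _ _ (way_below_le (Clt _ _ _ _ q't Cy Cu)) Uu.
exact: upU _ _ (way_below_le yz) Uy.
Qed.

Lemma weak_CC_chain_mass (R : realType) (d : Order.disp_t) (A : porderType d)
    (K : set A) (a b : A) (C : R -> set A) :
  continuous_with_basis K -> dense_chain a b C ->
  weak_CC (chain_mass C : set (scott A) -> R).
Proof.
move=> cK cC; have [_ C1 C01 _ _] := cC; split; [split|split].
- apply/eqP; rewrite eq_le (chain_mass_ge0 _ cC) andbT.
  by apply: chain_mass_le.
- apply/eqP; rewrite eq_le (chain_mass_le1 _ cC) /=.
  exact: chain_mass_ge cC C1 _.
- by move=> U V _ _; exact: chain_mass_subset cC.
- move=> U V oU oV.
  by rewrite (chain_massI cC oU oV) (chain_massU _ _ cC) addr_min_max.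
- move=> I U _ [[_ [i _ _]] _] e e0; apply: chain_mass_bigcup cC _ e0.
  exact: inhabits i.
- move=> I U oU [[_ [i _ _]] _] e e0; apply: chain_mass_bigcap cK cC _ e0 oU.
  exact: inhabits i.
Qed.

(** An open set without [b] meets the chain at no positive level and has mass [0]; a set with [a]
    reaches level [1]. *)
Lemma weak_CC_separating (R : realType) (d : Order.disp_t) (A : porderType d)
    (K : set A) (a b : A) :
  continuous_with_basis K -> way_below a b ->
  exists2 m : set (scott A) -> R, weak_CC m &
    forall U V : set (scott A), open U -> ~ U b -> V a -> m U < m V.
Proof.
move=> cK ab; have [C cC] := exists_dense_chain R cK ab.
exists (chain_mass C); first exact: weak_CC_chain_mass cK cC.
move=> U V [upU _] nUb Va; have [C0 C1 C01 Clt _] := cC.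
apply: (@lt_le_trans _ _ 1); last exact: chain_mass_ge cC C1 Va.
apply: (@le_lt_trans _ _ 0) => //; apply: chain_mass_le => // t x Ctx Ux.
rewrite leNgt; apply/negP => t0; apply: nUb; apply: upU Ux.
exact: way_below_le (Clt _ _ _ _ t0 C0 Ctx).
Qed.

(** * Dyadically weighted means *)

(** The weight of index [n] is [2^-(n+1)]; these weights sum to [1]. *)
Definition weighted (R : realType) (g : nat -> R) : nat -> R :=
  fun n => geometric 2^-1 2^-1 n * g n.

Definition wmean (R : realType) (g : nat -> R) : R := limn (series (weighted g)).

Lemma weight_ge0 (R : realType) (n : nat) : 0 <= geometric 2^-1 2^-1 n :> R.
Proof. by apply: geometric_ge0; rewrite invr_ge0. Qed.

Lemma cvg_series_weights (R : realType) :
  series (geometric (2^-1 : R) 2^-1) @ \oo --> (1 : R).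
Proof.
have h : 2^-1 / (1 - 2^-1) = 1 :> R.
  by rewrite (_ : 1 - 2^-1 = 2^-1) ?divff ?invr_eq0//; lra.
by rewrite -[X in _ --> X]h; apply: cvg_geometric_series; rewrite ger0_norm ?invr_ge0//; lra.
Qed.

Lemma is_cvg_weighted (R : realType) (g : nat -> R) :
  (forall n, 0 <= g n <= 1) -> cvgn (series (weighted g)).
Proof.
move=> g01; apply: (@series_le_cvg _ _ (geometric 2^-1 2^-1)).
- by move=> n; rewrite mulr_ge0 ?weight_ge0//; case/andP: (g01 n).
- by move=> n; exact: weight_ge0.
- by move=> n; rewrite ler_piMr ?weight_ge0//; case/andP: (g01 n).
- by apply/cvg_ex; exists 1; exact: cvg_series_weights.
Qed.

Lemma wmean1 (R : realType) : wmean (fun=> 1 : R) = 1.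
Proof.
rewrite /wmean; have -> : weighted (fun=> 1 : R) = geometric 2^-1 2^-1.
  by apply/funext => n; rewrite /weighted mulr1.
exact/cvg_lim/cvg_series_weights.
Qed.

Lemma wmean0 (R : realType) : wmean (fun=> 0 : R) = 0.
Proof.
rewrite /wmean; have -> : series (weighted (fun=> 0 : R)) = fun=> 0.
  by apply/funext => n; rewrite /series/= big1// => i _; rewrite /weighted mulr0.
exact: lim_cst.
Qed.

Lemma wmeanD (R : realType) (g h : nat -> R) :
  (forall n, 0 <= g n <= 1) -> (forall n, 0 <= h n <= 1) ->
  wmean (fun n => g n + h n) = wmean g + wmean h.
Proof.
move=> /is_cvg_weighted cg /is_cvg_weighted ch.
rewrite /wmean -(lim_seriesD cg ch); congr (limn (series _)).
by apply/funext => n; rewrite /weighted mulrDr.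
Qed.

Lemma wmeanB (R : realType) (g h : nat -> R) :
  (forall n, 0 <= g n <= 1) -> (forall n, 0 <= h n <= 1) ->
  wmean (fun n => g n - h n) = wmean g - wmean h.
Proof.
move=> /is_cvg_weighted cg /is_cvg_weighted ch.
rewrite /wmean -(lim_seriesB cg ch); congr (limn (series _)).
by apply/funext => n; rewrite /weighted mulrBr.
Qed.

Lemma series_le_wmean (R : realType) (g : nat -> R) (N : nat) :
  (forall n, 0 <= g n <= 1) -> series (weighted g) N <= wmean g.
Proof.
move=> g01; apply: nondecreasing_cvgn_le; last exact: is_cvg_weighted.
apply: nondecreasing_series => n _ _.
by rewrite mulr_ge0 ?weight_ge0//; case/andP: (g01 n).
Qed.

Lemma wmean_gt0 (R : realType) (g : nat -> R) (n : nat) :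
  (forall n, 0 <= g n <= 1) -> 0 < g n -> 0 < wmean g.
Proof.
(* The partial sum of length [n.+1] is the first that contains the positive term of index [n]. *)
move=> g01 gn; apply: lt_le_trans (series_le_wmean n.+1 g01).
rewrite seriesSr ltr_wpDl//.
  by apply: sumr_ge0 => i _; rewrite mulr_ge0 ?weight_ge0//; case/andP: (g01 i).
by rewrite mulr_gt0// /geometric/= mulr_gt0 ?exprn_gt0 ?invr_gt0.
Qed.

Lemma wmean_ge0 (R : realType) (g : nat -> R) :
  (forall n, 0 <= g n <= 1) -> 0 <= wmean g.
Proof. by move=> /(series_le_wmean 0); rewrite /series/= big_geq. Qed.

(* The mass beyond a large [N] is negligible, and the mean of [1 - g] over the
   first [N] indices is almost [1]. *)
Lemma wmean_small (R : realType) (e : R) :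
  0 < e -> exists N, forall g : nat -> R, (forall n, 0 <= g n <= 1) ->
    (forall n, (n < N)%N -> g n <= e) -> wmean g <= e + e.
Proof.
move=> e0.
have [N hN] : exists N, 1 - e <= series (geometric (2^-1 : R) 2^-1) N.
  have /cvgrPdist_lt/(_ e e0)[N _ /(_ N (leqnn N))] := @cvg_series_weights R.
  move=> /(le_lt_trans (ler_norm _)) /= hN; exists N; lra.
exists N => g g01 ge.
have h01 n : 0 <= 1 - g n <= 1 by have := g01 n; lra.
have := series_le_wmean N h01.
rewrite (@wmeanB _ (fun=> 1)) ?wmean1; [|by move=> _; rewrite ler01 lexx|by []].
suff : (1 - e) * series (geometric 2^-1 2^-1) N <= series (weighted (fun n => 1 - g n)) N.
  (* For [e <= 1] use [(1 - e)^2 >= 1 - 2e]; for larger [e] the bound holds because the mean is at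
     most [1]. *)
  have [e1|/ltW e1] := leP e 1.
    have : (1 - e) * (1 - e) <= (1 - e) * series (geometric 2^-1 2^-1) N.
      by rewrite ler_wpM2l// subr_ge0.
    have := sqr_ge0 e; rewrite expr2; lra.
  move=> _; have : 0 <= series (weighted (fun n => 1 - g n)) N.
    by apply: sumr_ge0 => i _; rewrite mulr_ge0 ?weight_ge0//; case/andP: (h01 i).
  lra.
rewrite /series/= mulr_sumr; apply: ler_sum_nat => i /andP[_ iN].
by rewrite /weighted mulrC ler_wpM2l ?weight_ge0// lerB ?ge.
Qed.

(* Finitely many indices can be handled by one [i], the others by the weights. *)
Lemma wmean_directed (R : realType) (I : Type) (r : I -> I -> Prop)
    (g : I -> nat -> R) (e : R) :
  inhabited I -> (forall i j, exists k, r i k /\ r j k) ->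
  (forall i j n, r i j -> g j n <= g i n) ->
  (forall i n, 0 <= g i n <= 1) ->
  (forall n e', 0 < e' -> exists i, g i n <= e') ->
  0 < e -> exists i, wmean (g i) <= e.
Proof.
move=> [i0] dir mono g01 gsmall e0.
have e20 : 0 < e / 2 by lra.
have [N hN] := wmean_small e20.
have [i hi] : exists i, forall n, (n < N)%N -> g i n <= e / 2.
  elim: N {hN} => [|N [i hi]]; first by exists i0.
  have [j hj] := gsmall N _ e20; have [k [ik jk]] := dir i j.
  exists k => n; rewrite ltnS leq_eqVlt => /predU1P[->|/hi gi].
    exact: le_trans (mono _ _ _ jk) hj.
  exact: le_trans (mono _ _ _ ik) gi.
by exists i; have := hN _ (g01 i) hi; lra.
Qed.

(** * From a separating sequence to a CC-valuation *)

Lemma directed_range (T I : Type) (le : T -> T -> Prop) (U : I -> T) :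
  directed le (range U) ->
  inhabited I /\ forall i j, exists k, le (U i) (U k) /\ le (U j) (U k).
Proof.
move=> [[_ [i _ _]] dir]; split=> [|j k]; first exact: inhabits i.
have [||_ [[l _ <-] jl kl]] := dir (U j) (U k); [by exists j|by exists k|].
by exists l.
Qed.

(** Both limit conditions concern the gaps between [m n (U i)] and the value of [m n] at the limit
    set. They lie in [[0, 1]], shrink along the system and are small for each [n], so
    [wmean_directed] makes their mean small. *)
Lemma CC_valuation_wmean (R : realType) (X : topologicalType)
    (m : nat -> set X -> R) :
  (forall n, weak_CC (m n)) ->
  (forall U V, open U -> open V -> U `<` V -> exists n, m n U < m n V) ->
  CC_valuation (fun U => (wmean (fun n => m n U))%:E).
Proof.
move=> mCC msep.
have m0 n : m n set0 = 0 by have [[]] := mCC n.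
have m1 n : m n setT = 1 by have [[]] := mCC n.
have mle n U V : open U -> open V -> U `<=` V -> m n U <= m n V.
  by have [[_ _ + _] _] := mCC n; apply.
have m01 U (oU : open U) n : 0 <= m n U <= 1.
  rewrite -{1}(m0 n) -(m1 n); apply/andP; split; apply: mle => //.
  - exact: open0.
  - exact: openT.
have mB U V (oU : open U) (oV : open V) (UV : U `<=` V) n : 0 <= m n V - m n U <= 1.
  by have := mle n _ _ oU oV UV; have := m01 _ oU n; have := m01 _ oV n; lra.
have wle U V : open U -> open V -> U `<=` V ->
    wmean (fun n => m n U) <= wmean (fun n => m n V).
  move=> oU oV UV; rewrite -subr_ge0 -wmeanB ?wmean_ge0//; try exact: m01.
  exact: mB.
split; [split|split].
- by move=> U oU; rewrite lee_fin wmean_ge0//; exact: m01.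
- by congr EFin; rewrite -[RHS]wmean0; congr wmean; apply/funext => n; rewrite m0.
- by move=> U V oU oV UV; rewrite lee_fin wle.
- move=> U V oU oV; rewrite -!EFinD -!wmeanD; try exact: m01.
  + congr (wmean _)%:E; apply/funext => n.
    by have [[_ _ _ +] _] := mCC n; apply.
  + exact/m01/openI.
  + exact/m01/openU.
- move=> I U oU dU; have [I0 dir] := directed_range dU.
  have oV : open (\bigcup_i U i) by exact: bigcup_open.
  have UV i : U i `<=` \bigcup_i U i by exact: bigcup_sup.
  apply/eqP; rewrite eq_le; apply/andP; split; last first.
    by apply: ge_ereal_sup => _ [i _ <-]; rewrite lee_fin wle.
  apply/lee_addgt0Pr => e e0.
  have [|||i hi] := @wmean_directed R I (fun i j => U i `<=` U j)
      (fun i n => m n (\bigcup_i U i) - m n (U i)) e I0 dir _ _ _ e0.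
  + by move=> i j n ij; rewrite lerB// mle.
  + by move=> i; exact: mB.
  + move=> n e' e'0; have [_ [/(_ _ _ oU dU _ e'0)[i hi] _]] := mCC n.
    by exists i; lra.
  rewrite wmeanB in hi; try exact: m01.
  apply: (@le_trans _ _ ((wmean (fun n => m n (U i)))%:E + e%:E)%E).
    by rewrite -EFinD lee_fin; lra.
  by apply: leeD => //; apply: ereal_sup_ubound; exists i.
- by rewrite /normalized -wmean1; congr (wmean _)%:E; apply/funext => n; rewrite m1.
- move=> U V oU oV UV; rewrite lte_fin -subr_gt0 -wmeanB; try exact: m01.
  have [n mn] := msep _ _ oU oV UV; apply: (@wmean_gt0 _ _ n).
    by apply: mB => //; exact: properW.
  by rewrite subr_gt0.
- move=> I U oU dU; have [I0 dir] := directed_range dU.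
  set V := interior _.
  have oV : open V by exact: open_interior.
  have VU i : V `<=` U i by move=> x /interior_subset; apply.
  apply/eqP; rewrite eq_le; apply/andP; split.
    by apply: le_ereal_inf_tmp => _ [i _ <-]; rewrite lee_fin wle.
  apply/lee_addgt0Pr => e e0.
  have [|||i hi] := @wmean_directed R I (fun i j => U j `<=` U i)
      (fun i n => m n (U i) - m n V) e I0 dir _ _ _ e0.
  + by move=> i j n ij; rewrite lerB// mle.
  + by move=> i; exact: mB.
  + move=> n e' e'0; have [_ [_ /(_ _ _ oU dU _ e'0)[i hi]]] := mCC n.
    by exists i; rewrite /V; lra.
  rewrite wmeanB in hi; try exact: m01.
  apply: (@le_trans _ _ ((wmean (fun n => m n (U i)))%:E)).
    by apply: ereal_inf_lbound; exists i.
  by rewrite -EFinD lee_fin; lra.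
Qed.

(** * Enumeration of the pairs of basis elements *)

Lemma countable_enum (T : Type) (D : set T) (x0 : T) :
  countable D -> exists f : nat -> T, forall x, D x -> exists n, f n = x.
Proof.
move=> /pfcard_geP[->|[f]]; first by exists (fun=> x0).
by exists f => x /(@surj _ _ _ _ f)[n _ <-]; exists n.
Qed.

Theorem theorem9p3p1 (R : realType) (d : Order.disp_t) (A : bPOrderType d)
    (K : set A) :
  is_dcpo A -> countable K -> continuous_with_basis K ->
  exists mu : set (scott A) -> \bar R, CC_valuation mu.
Proof.
move=> _ cntK cK.
have [f fP] := countable_enum (\bot%O, \bot%O) (countableX cntK cntK).
have /choice[m mP] n : exists m : set (scott A) -> R, weak_CC m /\
    (way_below (f n).1 (f n).2 -> forall U V : set (scott A),
       open U -> ~ U (f n).2 -> V (f n).1 -> m U < m V).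
  have [fn|nfn] := pselect (way_below (f n).1 (f n).2).
    by have [m mCC msep] := weak_CC_separating R cK fn; exists m.
  (* A pair not related by [<<] gets a filler obtained from [\bot << \bot], so that every index
     carries total mass [1]. *)
  have [m mCC _] := weak_CC_separating R cK (@way_below_bot _ A \bot%O).
  by exists m.
exists (fun U => (wmean (fun n => m n U))%:E).
apply: CC_valuation_wmean => [n|U V oU oV [UV nVU]]; first by have [] := mP n.
have [x [Vx nUx]] : exists x, V x /\ ~ U x.
  by apply: contrapT => h; apply: nVU => x Vx; apply: contrapT => nUx; apply: h; exists x.
(* As [U] is an upper set without [x], it misses [b << x]; a second step down inside [V] gives
   [a << b]. *)
have [b [Kb bx Vb]] := scott_open_basis cK oV Vx.
have [a [Ka ab Va]] := scott_open_basis cK oV Vb.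
have [n fn] := fP (a, b) (conj Ka Kb).
exists n; have [_] := mP n; rewrite fn; apply=> // Ub.
by apply: nUx; exact: oU.1 _ _ (way_below_le bx) Ub.
Qed.
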